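(* Let $N\ge 2$, let $\mathcal{P}^*\subset[1,N]$ be a non-empty set of primes, $K=N/(|\mathcal{P}^*|\log N)$ and $T^*(\alpha)=\sum_{p\in\mathcal{P}^*}e(p\alpha)$. Let $f$ be a non-decreasing positive function and $C>0$ be such that, for every $A\ge1$, every $(1/N)$-well spaced subset of $\mathscr{C}(\mathcal{P}^*,A)$ has at most $CA^2Kf(\log A)$ points. Then $$\int_0^1|T^*(\alpha)|\,d\alpha\ll \sqrt{\frac{|\mathcal{P}^*|\,f(\log N)}{\log N}},$$ where the implied constant depends only on $C$.
   Context: $e(x)=e^{2\pi i x}$. The set of $A$-cusps is $\mathscr{C}(\mathcal{P}^*,A)=\{\alpha\in\mathbb{R}/\mathbb{Z}: |T^*(\alpha)|\ge |\mathcal{P}^*|/A\}$. A set $\mathcal{X}\subset\mathbb{R}/\mathbb{Z}$ is $\delta$-well spaced if any two distinct points of it are at distance $\ge\delta$ in $\mathbb{R}/\mathbb{Z}$. *)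

(* Defs.v *)
From mathcomp Require Import all_boot all_order all_algebra finmap.
From mathcomp Require Import generic_quotient ring_quotient complex.
From mathcomp Require Import all_classical all_reals all_analysis.

Set Implicit Arguments.
Unset Strict Implicit.
Unset Printing Implicit Defensive.

Import Order.TTheory GRing.Theory Num.Theory.
Import numFieldNormedType.Exports.

Local Open Scope classical_set_scope.
Local Open Scope ring_scope.
Local Open Scope quotient_scope.

(* R/Z; Num.int_num_subdef is the predicate behind the qualifier Num.int. *)
Definition circle (R : realType) : zmodType :=
  Quotient.quot (@Num.int_num_subdef R : {pred R}).

Definition toCircle (R : realType) (x : R) : circle R :=
  \pi_(Quotient.quot (@Num.int_num_subdef R : {pred R})) x.

(* The quotient metric: the least distance between representatives. *)
Definition circle_dist (R : realType) (a b : circle R) : R :=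
  inf [set d | exists x y : R,
         [/\ toCircle x = a, toCircle y = b & d = `|x - y|]].

Definition well_spaced (R : realType) (delta : R) (X : set (circle R)) : Prop :=
  forall a b, X a -> X b -> a <> b -> delta <= circle_dist a b.

Definition e (R : realType) (x : R) : R[i] :=
  (cos (2 * pi * x) +i* sin (2 * pi * x))%C.

Definition Tstar (R : realType) (P : {fset nat}) (alpha : R) : R[i] :=
  \sum_(p <- P) e (p%:R * alpha).

(* The norm `|z| of z : R[i] lives in R[i]; normc is the R-valued modulus. *)
Definition absTstar (R : realType) (P : {fset nat}) (alpha : R) : R :=
  ComplexField.Normc.normc (Tstar P alpha).

(* Tstar P is 1-periodic, so a class is a cusp as soon as one of its
   representatives satisfies the inequality. *)
Definition cusps (R : realType) (P : {fset nat}) (A : R) : set (circle R) :=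
  [set toCircle alpha | alpha in
     [set alpha : R | #|` P|%:R / A <= absTstar P alpha]].

Definition at_most_points (R : realType) (T : choiceType) (X : set T) (M : R)
    : Prop :=
  finite_set X /\ #|` fset_set X|%:R <= M.

(* Main.v *)
Require Import Defs.
From mathcomp Require Import all_boot all_order all_algebra finmap.
From mathcomp Require Import complex generic_quotient ring_quotient.
From mathcomp Require Import all_classical all_reals all_analysis.
From mathcomp Require Import measurable_realfun ring lra zify.

Import Order.TTheory GRing.Theory Num.Theory.
Import numFieldNormedType.Exports.

Local Open Scope classical_set_scope.
Local Open Scope ring_scope.

(** Cut [0, 1] into 2m cells of length 1 / (2m), with m = floor (N / 2), and let
    x_j be a maximum point of |T*| in the j-th cell, so that the integral is at
    most the mean of the |T*(x_j)|. The x_j with j even, and those with j odd,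
    are (1/N)-well spaced, so the hypothesis yields
    #{j : |T*(x_j)| >= t} <= D / t^2 with D = C K f(log N) |P*|^2. A family of m
    numbers with this weak-type bound has sum at most 2 sqrt (D m), since its
    r-th largest member is at most sqrt (D / r). As N <= 4m, the resulting
    2 sqrt (D / m) is at most 4 sqrt (C |P*| f(log N) / log N). *)

(** * Summation under a weak-type bound *)

(** Induction along the increasing list, peeling off its least member [x]. If [x > 0], taking
    [t = x] among n members gives n x^2 <= D, so x <= sqrt (D / n) <= 2 (sqrt (D n) - sqrt (D (n -
    1))), and these increments telescope. *)
Lemma ler_sum_weak_type (R : realType) (D : R) (s : seq R) :
  0 <= D ->
  (forall t : R, 0 < t -> (count (>= t) s)%:R * t ^+ 2 <= D) ->
  \sum_(v <- s) v <= 2 * Num.sqrt (D * (size s)%:R).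
Proof.
move=> D0; rewrite -(perm_big _ (permEl (perm_sort <=%R s))) /=.
rewrite -(size_sort <=%R s) => Ds.
have {Ds} : forall t : R, 0 < t -> (count (>= t) (sort <=%R s))%:R * t ^+ 2 <= D.
  by move=> t t0; rewrite (permP (permEl (perm_sort <=%R s))); exact: Ds.
have := sort_sorted (@le_total _ R) s; move: (sort _ _) => {}s.
elim: s => [|x s IHs] /= ps Ds; first by rewrite big_nil mulr0 sqrtr0 mulr0.
rewrite big_cons.
have {}IHs : \sum_(v <- s) v <= 2 * Num.sqrt (D * (size s)%:R).
  apply: IHs (path_sorted ps) _ => t t0; apply: le_trans (Ds t t0).
  by rewrite ler_wpM2r ?sqr_ge0// ler_nat leq_addl.
set a := Num.sqrt _ in IHs; set b := Num.sqrt _.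
have a0 : 0 <= a by exact: sqrtr_ge0.
have b0 : 0 <= b by exact: sqrtr_ge0.
have aE : a ^+ 2 = D * (size s)%:R by rewrite sqr_sqrtr// mulr_ge0.
have bE : b ^+ 2 = D * (size s)%:R + D.
  by rewrite sqr_sqrtr ?mulr_ge0// -natr1; ring.
have ab : a <= b by apply: ler_wsqrtr; rewrite ler_wpM2l// ler_nat.
have [x0|x0] := leP x 0; first by lra.
have Dx : (size s).+1%:R * x ^+ 2 <= D.
  have := Ds x x0; rewrite lexx.
  suff -> : count (>= x) s = size s by [].
  by apply/eqP; rewrite -all_count; exact: order_path_min le_trans ps.
have Dgt0 : 0 < D by apply: lt_le_trans Dx; rewrite mulr_gt0// exprn_gt0.
have bgt0 : 0 < b by rewrite sqrtr_gt0 mulr_gt0.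
have xbD : x * b <= D.
  rewrite -(@ler_pXn2r _ 2)// ?nnegrE ?mulr_ge0 ?(ltW x0)//.
  have := ler_wpM2l D0 Dx; rewrite exprMn bE -natr1; lra.
(* Here D = b^2 - a^2 = (b - a) (b + a) <= 2 (b - a) b. *)
suff : x * b <= 2 * (b - a) * b by rewrite ler_pM2r//; lra.
apply: le_trans xbD _; nra.
Qed.

(** * Separation on the circle *)

Lemma toCircle_eq (R : realType) (x y : R) :
  toCircle x = toCircle y -> exists k : int, x - y = k%:~R.
Proof.
by move=> /eqmodP /=; rewrite Quotient.equivE => /intrP.
Qed.

(** Representatives of the two classes differ by [x - y] up to an integer, so a bound uniform in the
    shift [k] bounds the infimum. *)
Lemma le_circle_dist (R : realType) (delta x y : R) :
  (forall k : int, delta <= `|x - y + k%:~R|) ->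
  delta <= circle_dist (toCircle x) (toCircle y).
Proof.
move=> dxy; apply: lb_le_inf; first by exists `|x - y|, x, y.
move=> _ [x' [y' [/toCircle_eq[k xk] /toCircle_eq[l yl] ->]]].
have -> : x' - y' = x - y + (k - l)%:~R by rewrite rmorphB /= -xk -yl; ring.
exact: dxy.
Qed.

(** Separation also keeps the classes distinct, so counting points of the circle counts indices: a
    collision would make some shifted difference vanish, against [0 < delta]. *)
Lemma well_spaced_image (R : realType) (delta : R) (x : nat -> R)
    (S : {fset nat}) :
  0 < delta ->
  (forall i j, i \in S -> j \in S -> i != j ->
    forall k : int, delta <= `|x i - x j + k%:~R|) ->
  let X := [set toCircle (x i) | i in [set` S]] in
  well_spaced delta X /\ #|` fset_set X| = #|` S|.
Proof.
move=> d0 dS X; split.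
  move=> _ _ [i Si <-] [j Sj <-] ij; apply: le_circle_dist.
  by apply: dS => //; apply: contra_not_neq ij => ->.
rewrite fset_set_image// set_fsetK card_in_imfset//= => i j Si Sj.
move=> /toCircle_eq[k xk]; apply/eqP; apply: contraTT d0 => ij; rewrite -leNgt.
by have := dS i j Si Sj ij (- k); rewrite xk rmorphN subrr normr0.
Qed.

(* Points in the cells of even (or odd) index of a uniform subdivision of the
   circle into an even number of cells are separated by a full cell. *)
Lemma alternate_cells_spaced (R : realType) (m s : nat) (x : nat -> R) :
  let h := (2 * m)%:R^-1 in
  (forall j, (j < m)%N ->
    (2 * j + s)%:R * h <= x j <= (2 * j + s).+1%:R * h) ->
  forall i j, (i < m)%N -> (j < m)%N -> i != j ->
  forall k : int, h <= `|x i - x j + k%:~R|.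
Proof.
move=> h xh i j im jm ij k.
have m0 : (0 < m)%N by exact: leq_ltn_trans im.
have h0 : 0 < h by rewrite invr_gt0 ltr0n; lia.
have mh : 2 * m%:R * h = 1 :> R.
  by rewrite -natrM mulfV// pnatr_eq0; lia.
have := xh i im; have := xh j jm.
rewrite -!natr1 !natrD => /andP[xj1 xj2] /andP[xi1 xi2].
(* After the shift by [k], the left ends of the two cells are 2 |q| h apart, a period being 2m
   cells. Since |i - j| < m, [q] is nonzero; the positions inside cells of length [h] lose at most
   [h]. *)
pose q : int := i%:Z - j%:Z + m%:Z * k.
have q0 : (1 <= q) || (q <= -1).
  suff : q != 0 by lia.
  apply/negP => /eqP; rewrite /q => q0.
  have [k0|[k1|k1]] : k = 0 \/ 1 <= k \/ k <= -1 by lia.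
  - by move: q0 ij; rewrite k0; lia.
  - by nia.
  - by nia.
have qE : q%:~R = i%:R - j%:R + m%:R * k%:~R :> R.
  by rewrite /q rmorphD rmorphB rmorphM.
have kE : k%:~R = 2 * (m%:R * k%:~R) * h :> R.
  by rewrite -[LHS]mul1r -{1}mh; ring.
have : 1 <= q%:~R :> R \/ q%:~R <= -1 :> R.
  by case/orP: q0 => q0; [left|right]; rewrite -?(ler_int R) in q0.
rewrite ler_normr kE qE => -[] q1; apply/orP; [left|right]; nra.
Qed.

(** * Continuity and size of the exponential sum *)

Lemma TstarE (R : realType) (P : {fset nat}) (a : R) :
  Tstar P a = ((\sum_(p <- P) cos (2 * pi * (p%:R * a))) +i*
               (\sum_(p <- P) sin (2 * pi * (p%:R * a))))%C.
Proof.
rewrite /Tstar; elim/big_rec3 : _ => //= p x y z _ ->.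
by [].
Qed.

(** Provides the maximum point in each cell and the measurability of the integrand. *)
Lemma absTstar_continuous (R : realType) (P : {fset nat}) :
  continuous (absTstar P : R -> R).
Proof.
have cvg_sum (g : nat -> R -> R) : (forall p, continuous (g p)) ->
    continuous (fun a => \sum_(p <- P) g p a).
  move=> gc a; elim: (P : seq nat) => [|p s IHs].
    rewrite (_ : (fun _ => _) = cst 0); first exact: cvg_cst.
    by apply/funext => b; rewrite big_nil.
  rewrite (_ : (fun _ => _) = g p \+ fun b => \sum_(q <- s) g q b).
    by apply: continuousD; [exact: gc|exact: IHs].
  by apply/funext => b; rewrite big_cons.
have lin p : continuous (fun a : R => 2 * pi * (p%:R * a)).
  by move=> a; do 2 (apply: cvgM; first exact: cvg_cst); exact: cvg_id.
have -> : absTstar P = fun a : R => Num.sqrt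
    ((\sum_(p <- P) cos (2 * pi * (p%:R * a))) ^+ 2 +
     (\sum_(p <- P) sin (2 * pi * (p%:R * a))) ^+ 2).
  by apply/funext => a; rewrite /absTstar TstarE.
have comp (u w : R -> R) : continuous u -> continuous w ->
    continuous (fun a => w (u a)).
  by move=> uc wc a; apply: continuous_comp; [exact: uc|exact: wc].
apply: (comp _ (@Num.sqrt R)); last exact: sqrt_continuous.
have sqc := @exprn_continuous R 2.
have add (u w : R -> R) : continuous u -> continuous w ->
    continuous (fun a => u a + w a).
  by move=> uc wc a; apply: cvgD; [exact: uc|exact: wc].
apply: add.
- apply: (comp _ (fun z => z ^+ 2)) => //; apply: cvg_sum => p.
  exact: comp (lin p) (@continuous_cos R).
- apply: (comp _ (fun z => z ^+ 2)) => //; apply: cvg_sum => p.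
  exact: comp (lin p) (@continuous_sin R).
Qed.

Lemma absTstar_ge0 (R : realType) (P : {fset nat}) (a : R) :
  0 <= absTstar P a.
Proof. by rewrite /absTstar TstarE sqrtr_ge0. Qed.

Lemma absTstar_le (R : realType) (P : {fset nat}) (a : R) :
  absTstar P a <= #|` P|%:R.
Proof.
rewrite /absTstar /Tstar -sum1_size natr_sum; elim/big_rec2 : _.
  by rewrite ComplexField.Normc.normc0.
move=> p u z _ zu; apply: le_trans (le_normcD _ _) _.
by rewrite lerD// /e /= cos2Dsin2 sqrtr1.
Qed.

Lemma absTstar0 (R : realType) (P : {fset nat}) :
  absTstar P (0 : R) = #|` P|%:R.
Proof.
rewrite /absTstar TstarE.
under eq_bigr do rewrite !mulr0 cos0.
under [X in (_ +i* X)%C]eq_bigr do rewrite !mulr0 sin0.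
rewrite big1_eq /= expr0n addr0 sqrtr_sqr ger0_norm ?sumr_ge0//.
by rewrite -sum1_size natr_sum.
Qed.

(** * Comparison of the integral with a sum over cells *)

(** The integrand is dominated by a step function built on closed cells; where these overlap, its
    value only grows, as every [v j] is nonnegative. *)
Lemma integral01_le_sum_cells (R : realType) (g : R -> R) (v : nat -> R)
    (n : nat) :
  (0 < n)%N -> continuous g -> (forall x, 0 <= g x) ->
  (forall (j : nat) x, (j < n)%N ->
    j%:R * n%:R^-1 <= x <= j.+1%:R * n%:R^-1 -> g x <= v j) ->
  (\int[@lebesgue_measure R]_(x in `[0%R, 1%R]) (g x)%:E
    <= (n%:R^-1 * \sum_(j < n) v j)%:E)%E.
Proof.
move=> n0 gc g0 gv; set h := n%:R^-1.
have h0 : 0 < h by rewrite invr_gt0 ltr0n.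
pose I (j : nat) : set R := [set` `[j%:R * h, j.+1%:R * h]].
have v0 j : (j < n)%N -> 0 <= v j.
  move=> jn; apply: le_trans (g0 (j%:R * h)) (gv j _ jn _).
  by rewrite lexx ler_wpM2r ?(ltW h0)// ler_nat.
have mI j : measurable (I j) by exact: measurable_itv.
have mterm (j : 'I_n) : measurable_fun (`[0%R, 1%R]%classic : set R)
    (fun x => (v j * \1_(I j) x)%:E).
  apply/measurable_EFinP; apply: measurable_funM; first exact: measurable_cst.
  by apply: measurable_indic; exact: mI.
have term0 (j : 'I_n) x : (0 <= (v j * \1_(I j) x)%:E)%E.
  by rewrite lee_fin mulr_ge0// v0.
apply: (@le_trans _ _ (\int[lebesgue_measure]_(x in `[0%R, 1%R])
   (\sum_(j < n) (v j * \1_(I j) x)%:E)))%E.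
  apply: ge0_le_integral => //=.
  - by move=> x _; rewrite lee_fin.
  - apply/measurable_EFinP; apply: measurable_funTS.
    exact: continuous_measurable_fun.
  - by apply: emeasurable_sum => j; exact: mterm.
  move=> x; rewrite in_itv/= => /andP[x0 x1].
  have [j [jn Ij]] : exists j, (j < n)%N /\ I j x.
    have nx0 : 0 <= n%:R * x by rewrite mulr_ge0.
    (* The endpoint [x = 1] goes to the last cell, since its index [truncn (n x)] would be n, out of
       range. *)
    have [xn|xn] := ltP x 1; last first.
      exists n.-1; split; first by rewrite prednK.
      rewrite /I /= in_itv /= prednK// /h mulfV ?pnatr_eq0 -?lt0n// x1 andbT.
      by apply: le_trans xn; rewrite ler_pdivrMr ?ltr0n// mul1r ler_nat leq_pred.
    exists (Num.truncn (n%:R * x)); have /andP[t1 t2] := truncn_itv nx0.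
    split; last first.
      rewrite /I /= in_itv /= ler_pdivrMr ?ltr0n// ler_pdivlMr ?ltr0n//.
      by rewrite -(mulrC n%:R) t1 ltW.
    rewrite -(ltr_nat R); apply: le_lt_trans t1 _.
    by rewrite -[ltRHS]mulr1 ltr_pM2l ?ltr0n.
  rewrite sumEFin lee_fin (bigD1 (Ordinal jn))//= indicE mem_set// mulr1.
  rewrite -[leLHS]addr0 lerD ?gv//.
  by apply: sumr_ge0 => i _; have := term0 i x; rewrite lee_fin.
rewrite ge0_integral_sum// mulr_sumr -sumEFin; apply: lee_sum => j _.
under eq_integral do rewrite EFinM.
rewrite ge0_integralZl_EFin ?v0//; last first.
  by apply/measurable_EFinP; exact: measurable_indic (mI j).
rewrite integral_indic//; last exact: mI.
rewrite [leRHS]EFinM [leRHS]muleC lee_wpmul2l ?lee_fin ?v0//.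
apply: (@le_trans _ _ (lebesgue_measure (I j))).
  apply: le_measure => //; last by rewrite inE; exact: (mI j).
  by rewrite inE; apply: measurableI => //; exact: (mI j).
rewrite lebesgue_measure_itv /= lte_fin.
by rewrite ltr_pM2r// ltr_nat ltnSn -EFinD lee_fin -natr1; lra.
Qed.

(** * Large values at spaced points, counted through cusps *)

(* The class of [0] is a [1]-cusp, which forces [1 <= C * K * f 0]; hence the
   counting bound holds trivially at heights [t < #|P| / N], where the
   hypothesis on cusps would involve [f (ln A)] with [A > N]. *)
Lemma sum_absTstar_spaced (R : realType) (C N : R) (P : {fset nat})
    (f : R -> R) (m : nat) (x : nat -> R) :
  0 < C -> 2 <= N -> P != fset0 ->
  (forall x y : R, 0 <= x -> x <= y -> f x <= f y) ->
  let K := N / (#|` P|%:R * ln N) in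
  (forall A : R, 1 <= A ->
     forall X : set (circle R),
       X `<=` cusps P A -> well_spaced (1 / N) X ->
       at_most_points X (C * A ^+ 2 * K * f (ln A))) ->
  m%:R <= N ->
  (forall i j, (i < m)%N -> (j < m)%N -> i != j ->
    forall k : int, N^-1 <= `|x i - x j + k%:~R|) ->
  \sum_(j < m) absTstar P (x j) <=
    2 * Num.sqrt (C * K * f (ln N) * #|` P|%:R ^+ 2 * m%:R).
Proof.
move=> C0 N2 P0 f_nd K cuspsP mN xsp.
have N0 : 0 < N by lra.
have lnN0 : 0 < ln N by rewrite ln_gt0//; lra.
have card0 : 0 < #|` P|%:R :> R by rewrite ltr0n cardfs_gt0.
have K0 : 0 < K by rewrite divr_gt0// mulr_gt0.
have CKf0 : 1 <= C * K * f 0.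
  have [||_] := cuspsP 1 (lexx _) [set toCircle 0].
  - by move=> _ ->; exists 0 => //=; rewrite absTstar0 divr1.
  - by move=> _ _ -> ->.
  by rewrite fset_set1 cardfs1 ln1 expr1n mulr1.
have CKfN : 1 <= C * K * f (ln N).
  apply: le_trans CKf0 _; rewrite ler_wpM2l ?f_nd ?(ltW lnN0)//.
  by rewrite ltW// mulr_gt0.
set D := C * K * f (ln N) * #|` P|%:R ^+ 2.
have PD : #|` P|%:R ^+ 2 <= D by rewrite ler_peMl// sqr_ge0.
have D0 : 0 <= D by apply: le_trans PD; exact: sqr_ge0.
rewrite -(big_mkord predT (fun j => absTstar P (x j))).
rewrite -(big_map (fun j => absTstar P (x j)) predT id).
set s := map _ _; have sm : size s = m by rewrite size_map size_iota subn0.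
rewrite -{1}sm; apply: ler_sum_weak_type => // t t0.
have [tN|tN] := ltP t (#|` P|%:R / N).
  have tN0 : t * N <= #|` P|%:R by rewrite -ler_pdivlMr// ltW.
  have ctN : (count (>= t) s)%:R <= N.
    by apply: le_trans mN; rewrite ler_nat -sm count_size.
  (* The count is at most N, so count t^2 <= N t^2 <= (t N)^2 <= |P|^2 <= D. *)
  have N1 : N <= N ^+ 2 by nra.
  apply: le_trans PD.
  apply: (@le_trans _ _ ((t * N) ^+ 2)).
    rewrite exprMn mulrC ler_wpM2l ?sqr_ge0//.
    exact: le_trans N1.
  by rewrite lerXn2r// nnegrE ?mulr_ge0 ?(ltW t0) ?(ltW N0) ?(ltW card0).
pose S := [fset j in [seq j <- iota 0 m | t <= absTstar P (x j)]]%fset.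
have inS j : j \in S -> (j < m)%N /\ t <= absTstar P (x j).
  by rewrite !inE mem_filter mem_iota add0n => /and3P[].
have cS : count (>= t) s = #|` S|.
  rewrite count_map card_fseq undup_id ?filter_uniq ?iota_uniq//.
  by rewrite size_filter /index_iota subn0.
(* No value exceeds |P|; for other heights, A = |P| / t is at least 1 and turns the cusp threshold
   |P| / A into [t]. *)
have [tP|tP] := ltP #|` P|%:R t.
  rewrite cS (_ : S = fset0) ?cardfs0 ?mul0r//.
  apply/eqP; rewrite -fsubset0; apply/fsubsetP => j /inS[_].
  by move=> /le_trans/(_ (absTstar_le _ _ _))/(lt_le_trans tP); rewrite ltxx.
have t_le_P : 1 <= #|` P|%:R / t by rewrite ler_pdivlMr ?mul1r.
have [] := @well_spaced_image R (1 / N) x S.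
- by rewrite div1r invr_gt0.
- move=> i j /inS[im _] /inS[jm _] ij k; rewrite div1r; exact: xsp.
move=> Xsp Xcard.
have [|//|_] := cuspsP _ t_le_P [set toCircle (x i) | i in [set` S]].
  move=> _ [i /inS[_ ti] <-]; exists (x i) => //=.
  by rewrite invf_div mulrCA mulfV ?mulr1// lt0r_neq0.
rewrite Xcard -cS => /le_trans H.
rewrite -ler_pdivlMr ?exprn_gt0//; apply: H.
have -> : D / t ^+ 2 = C * (#|` P|%:R / t) ^+ 2 * K * f (ln N).
  by rewrite /D expr_div_n; ring.
rewrite ler_wpM2l//.
  by rewrite mulr_ge0 ?(ltW K0)// mulr_ge0 ?(ltW C0)// sqr_ge0.
(* The lower bound |P| / N <= t enters here: it says A <= N. *)
apply: f_nd; first exact: ln_ge0.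
rewrite ler_ln ?posrE ?divr_gt0//.
by rewrite ler_pdivrMr// mulrC -ler_pdivrMr.
Qed.

(** * Splitting by parity and the final estimate *)

Lemma sum_even_odd (V : zmodType) (v : nat -> V) (m : nat) :
  \sum_(j < 2 * m) v j =
  \sum_(j < m) v (2 * j)%N + \sum_(j < m) v (2 * j).+1.
Proof.
elim: m => [|m IHm]; first by rewrite !big_ord0 addr0.
rewrite mulnS !addSn add0n !big_ord_recr /= IHm.
by rewrite -!addrA; congr (_ + _); rewrite addrCA.
Qed.

Theorem theorem2 (R : realType) (C : R) (hC : 0 < C) :
  exists c : R, 0 < c /\
    forall (N : R) (P : {fset nat}) (f : R -> R),
      2 <= N ->
      P != fset0 ->
      (forall p : nat, p \in P -> prime p /\ 1 <= (p%:R : R) <= N) ->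
      (forall x y : R, 0 <= x -> x <= y -> f x <= f y) ->
      (forall x : R, 0 <= x -> 0 < f x) ->
      let K := N / (#|` P|%:R * ln N) in
      (forall A : R, 1 <= A ->
         forall X : set (circle R),
           X `<=` cusps P A -> well_spaced (1 / N) X ->
           at_most_points X (C * A ^+ 2 * K * f (ln A))) ->
      (\int[@lebesgue_measure R]_(alpha in `[0%R, 1%R])
          (absTstar P alpha)%:E
        <= (c * Num.sqrt (#|` P|%:R * f (ln N) / ln N))%:E)%E.
Proof.
(* Two parity classes contribute a factor 2 each from the weak-type summation, whence the 4. *)
exists (4 * Num.sqrt C); split; first by rewrite mulr_gt0// sqrtr_gt0.
move=> N P f N2 P0 _ f_nd f_gt0 K cuspsP.
have N0 : 0 < N by lra.
have lnN0 : 0 < ln N by rewrite ln_gt0//; lra.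
have card0 : 0 < #|` P|%:R :> R by rewrite ltr0n cardfs_gt0.
(* The largest m for which the cell length 1 / (2m) is still at least 1 / N; it is positive because
   N >= 2. *)
pose m := Num.truncn (N / 2).
have N20 : 0 <= N / 2 by lra.
have /andP[mN Nm] := truncn_itv N20; rewrite -/m in mN Nm.
rewrite -(natr1 m) in Nm.
have m0 : (0 < m)%N by rewrite -(ltr_nat R); lra.
have m1 : 1 <= m%:R :> R by rewrite ler1n.
have m20 : (0 < 2 * m)%N by rewrite muln_gt0.
set h : R := (2 * m)%:R^-1.
have h0 : 0 < h by rewrite invr_gt0 ltr0n.
have Nh : N^-1 <= h.
  by rewrite lef_pV2 ?posrE ?ltr0n// natrM; lra.
have /choice[x xP] : forall j : nat, exists y : R,
    (j%:R * h <= y <= j.+1%:R * h) /\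
    forall t, j%:R * h <= t <= j.+1%:R * h -> absTstar P t <= absTstar P y.
  move=> j; have jh : j%:R * h <= j.+1%:R * h.
    by rewrite ler_wpM2r ?(ltW h0)// ler_nat.
  have [] := EVT_max jh (continuous_subspaceT (@absTstar_continuous R P)).
  by move=> y; rewrite in_itv/= => ? ymax; exists y; split.
have spaced s : \sum_(j < m) absTstar P (x (2 * j + s)%N) <=
    2 * Num.sqrt (C * K * f (ln N) * #|` P|%:R ^+ 2 * m%:R).
  apply: (@sum_absTstar_spaced R C N P f m (fun j => x (2 * j + s)%N)) => //.
    by lra.
  move=> i j im jm ij k; apply: le_trans Nh _.
  apply: (@alternate_cells_spaced R m s (fun j => x (2 * j + s)%N)) => // l _.
  by have [] := xP (2 * l + s)%N.
have sum_le : \sum_(j < 2 * m) absTstar P (x j) <=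
    4 * Num.sqrt (C * K * f (ln N) * #|` P|%:R ^+ 2 * m%:R).
  rewrite (sum_even_odd _ (fun j => absTstar P (x j))).
  have := lerD (spaced 0%N) (spaced 1%N).
  under eq_bigr do rewrite addn0.
  under [X in _ + X <= _ -> _]eq_bigr do rewrite addn1.
  by lra.
have int_le := integral01_le_sum_cells _ _ (fun j => absTstar P (x j)) _ m20
  (@absTstar_continuous R P) (@absTstar_ge0 R P)
  (fun j t _ => (xP j).2 t).
apply: le_trans int_le _; rewrite lee_fin -/h.
set q := #|` P|%:R * f (ln N) / ln N.
have q0 : 0 <= q.
  by rewrite divr_ge0 ?mulr_ge0 ?(ltW lnN0) ?(ltW card0)// ltW// f_gt0// ltW.
have -> : 4 * Num.sqrt C * Num.sqrt q =
    h * (4 * (Num.sqrt (C * q) * (2 * m)%:R)).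
  rewrite (sqrtrM _ (ltW hC)) /h; field.
  by rewrite pnatr_eq0 -lt0n.
rewrite ler_wpM2l ?(ltW h0)//; apply: le_trans sum_le _.
have Cq0 : 0 <= C * q by apply: mulr_ge0 => //; exact: ltW.
have -> : Num.sqrt (C * q) * (2 * m)%:R = Num.sqrt (C * q * (2 * m)%:R ^+ 2).
  by rewrite (sqrtrM _ Cq0) sqrtr_sqr ger0_norm.
rewrite ler_wpM2l//; apply: ler_wsqrtr.
have -> : C * K * f (ln N) * #|` P|%:R ^+ 2 * m%:R = C * q * (N * m%:R).
  by rewrite /K /q; field; rewrite !lt0r_neq0.
(* What remains is N m <= (2m)^2, that is N <= 4m, which follows from N / 2 < m + 1 <= 2m. *)
rewrite ler_wpM2l// natrM; nra.
Qed.
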